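(* Let $U_7^5=\{L(C)\in TLeib_7 : c_{2,3}\neq 0,\ c_{1,1}=c_{0,1}=c_{1,2}=0,\ c_{1,3}\neq 0\}$. 1. Two algebras $L(C)$ and $L(C')$ from $U_7^5$ are isomorphic if and only if $\frac{{c'}_{2,3}^{6}c'_{0,0}}{{c'}_{1,3}^{5}}=\frac{c_{2,3}^6c_{0,0}}{c_{1,3}^5}$. 2. For any $\lambda\in\mathbb{C}$ there exists $L(C)\in U_7^5$ with $\frac{c_{2,3}^6c_{0,0}}{c_{1,3}^5}=\lambda$. Moreover, the orbits (isomorphism classes) in $U_7^5$ are parameterized by the algebras $L(\lambda,0,0,0,1,0,1)$, $\lambda\in\mathbb{C}$: these algebras lie in $U_7^5$ and every algebra in $U_7^5$ is isomorphic to one of them.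
   Context: All algebras are over $\mathbb{C}$. For $C=(c_{0,0},c_{0,1},c_{1,1},c_{1,2},c_{1,3},c_{1,4},c_{2,3})\in\mathbb{C}^7$, $L(C)$ denotes the $7$-dimensional complex (Leibniz) algebra with basis $e_0,e_1,\dots,e_6$ and products (products of basis vectors not listed are zero): $[e_i,e_0]=e_{i+1}$ for $1\le i\le 5$; $[e_0,e_i]=-e_{i+1}$ for $2\le i\le 5$; $[e_0,e_0]=c_{0,0}e_6$; $[e_0,e_1]=-e_2+c_{0,1}e_6$; $[e_1,e_1]=c_{1,1}e_6$; $[e_1,e_2]=-[e_2,e_1]=c_{1,2}e_4+c_{1,3}e_5+c_{1,4}e_6$; $[e_1,e_3]=-[e_3,e_1]=c_{1,2}e_5+c_{1,3}e_6$; $[e_1,e_4]=-[e_4,e_1]=(c_{1,2}-c_{2,3})e_6$; $[e_2,e_3]=-[e_3,e_2]=c_{2,3}e_6$. $TLeib_7$ is the set of all $L(C)$, $C\in\mathbb{C}^7$. The entries of $C'$ are denoted $c'_{i,j}$, in the same order. ''Isomorphic'' means isomorphic as algebras over $\mathbb{C}$; an orbit is an isomorphism class. *)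

(* Defs.v *)
(* MathComp / MathComp-Analysis *)
From HB Require Import structures.
From mathcomp Require Import all_boot all_order all_algebra.
From mathcomp Require Import classical_sets.

Set Implicit Arguments.
Unset Strict Implicit.
Unset Printing Implicit Defensive.

Import GRing.Theory.
Local Open Scope ring_scope.
Local Open Scope classical_set_scope.

(* An algebra (not assumed associative or unital) over K with underlying space
   V is its product, i.e. a bilinear map V -> V -> V. *)
Definition isomorphic (K : fieldType) (V W : lmodType K)
    (mulV : {bilinear V -> V -> V}) (mulW : {bilinear W -> W -> W}) : Prop :=
  exists2 f : {linear V -> W}, bijective f &
    forall x y : V, f (mulV x y) = mulW (f x) (f y).

Record params (K : Type) := Params {
  c00 : K; c01 : K; c11 : K; c12 : K; c13 : K; c14 : K; c23 : K }.

Section TLeib.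

Variable K : fieldType.
Implicit Types (C : params K) (i j k : nat) (x y : 'rV[K]_7).

(* Meaningful for k <= 6 only. *)
Definition e k : 'rV[K]_7 := delta_mx 0 (inord k).

(* The product [e_i, e_j] in L(C). *)
Definition basis_mul C i j : 'rV[K]_7 :=
  let e12 := c12 C *: e 4 + c13 C *: e 5 + c14 C *: e 6 in
  let e13 := c12 C *: e 5 + c13 C *: e 6 in
  let e14 := (c12 C - c23 C) *: e 6 in
  let e23 := c23 C *: e 6 in
  match i, j with
  | 0%N, 0%N => c00 C *: e 6
  | 0%N, 1%N => - e 2 + c01 C *: e 6
  | 0%N, k => if (2 <= k <= 5)%N then - e k.+1 else 0
  | k, 0%N => if (1 <= k <= 5)%N then e k.+1 else 0
  | 1%N, 1%N => c11 C *: e 6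
  | 1%N, 2%N => e12 | 2%N, 1%N => - e12
  | 1%N, 3%N => e13 | 3%N, 1%N => - e13
  | 1%N, 4%N => e14 | 4%N, 1%N => - e14
  | 2%N, 3%N => e23 | 3%N, 2%N => - e23
  | _, _ => 0
  end.

Definition L_mul C x y : 'rV[K]_7 :=
  \sum_(i < 7) \sum_(j < 7) (x 0 i * y 0 j) *: basis_mul C i j.

Lemma L_mul_is_bilinear C : bilinear_for *:%R *:%R (L_mul C).
Proof.
split=> [y a x x' | x a y y'] /=; rewrite /L_mul scaler_sumr -big_split /=;
  apply: eq_bigr => i _; rewrite scaler_sumr -big_split /=;
  apply: eq_bigr => j _; rewrite !mxE scalerA -scalerDl; congr (_ *: _).
  by rewrite mulrDl mulrA.
by rewrite mulrDr mulrCA.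
Qed.

HB.instance Definition _ C :=
  bilinear_isBilinear.Build K _ _ _ _ _ (L_mul C) (L_mul_is_bilinear C).

Definition L C : {bilinear 'rV[K]_7 -> 'rV[K]_7 -> 'rV[K]_7} := L_mul C.

Lemma L_basis C i j : (i < 7)%N -> (j < 7)%N ->
  L C (e i) (e j) = basis_mul C i j.
Proof.
move=> lti ltj; rewrite /L /= /L_mul (bigD1 (inord i)) //=.
rewrite (bigD1 (inord j)) //= !big1 ?addr0 => [|k ne_k|k ne_k].
- by rewrite !mxE !eqxx mulr1 scale1r !inordK.
- by rewrite big1 // => l _; rewrite !mxE (negPf ne_k) /= mul0r scale0r.
by rewrite !mxE (negPf ne_k) /= mulr0 scale0r.
Qed.

Definition U75 : set {bilinear 'rV[K]_7 -> 'rV[K]_7 -> 'rV[K]_7} :=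
  [set L C | C in [set C | [/\ c23 C != 0,
     [/\ c11 C = 0, c01 C = 0 & c12 C = 0] & c13 C != 0]]].

End TLeib.

(* Main.v *)
Require Import Defs.
From HB Require Import structures.
From mathcomp Require Import all_boot all_order all_algebra.
From mathcomp Require Import complex reals ring.

(** Write a and b for the leading coefficients of an isomorphism f from L(C) to
L(C'): f(e_0) = a e_0 + ... and f(e_1) = b e_1 + ...  The algebra is generated by
e_0 and e_1, since e_(i+1) = [e_i, e_0] for 1 <= i <= 5, and bracketing with e_0
shifts the filtration by the spans of e_k, ..., e_6 one step, whereas every
product involving only basis vectors of index at least 1 shifts it further.  When
c_12 vanishes, [e_1, e_2] lies two filtration steps deeper than [e_0, e_2], which
forces f(e_1) to have no e_0 component; then f(e_i) has leading term
a^(i-1) b e_i for i >= 2.  Comparing leading terms of the images of [e_2, e_3],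
[e_1, e_2] and [e_0, e_0] gives
  c'_23 b = c_23 a^2,   c'_13 b = c_13 a^3,   c'_00 = c_00 a^3 b
([isomorphic_coefs]), and eliminating a and b leaves exactly the equality of
c_23^6 c_00 / c_13^5.

Conversely, if these quantities agree, the three equations can be solved for
nonzero a and b.  The remaining coefficient c_14 is adjusted by taking
f(e_0) = a e_0 and f(e_1) = b e_1 + g e_2: the e_6 component of
[f(e_1), f(e_2)] acquires a term in g^2 c'_23, while the terms linear in g cancel
([isomorphic_triangular]).  So c_14 imposes one equation on g^2, solvable over an
algebraically closed field.

The algebra with parameters (l, 0, 0, 0, 1, 0, 1) has invariant l, so these
algebras meet every orbit. *)

Import GRing.Theory.
Local Open Scope ring_scope.
Local Open Scope complex_scope.

(** * Coordinates *)

(* The index goes through inord, as it does for the basis vectors e k, so that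
   entries can be named by numerals. *)
Local Notation "x # k" := (x ord0 (inord k)) (at level 2, format "x # k").

Definition row7 {K : fieldType} (s : seq K) : 'rV[K]_7 := \row_(k < 7) s`_k.

Lemma row7E (K : fieldType) (s : seq K) k : (k < 7)%N -> (row7 s)#k = s`_k.
Proof. by move=> ltk7; rewrite mxE inordK. Qed.

Lemma row7P (K : fieldType) (x y : 'rV[K]_7) :
  (forall k, (k < 7)%N -> x#k = y#k) -> x = y.
Proof. by move=> eqxy; apply/rowP=> k; have := eqxy k (ltn_ord k); rewrite inord_val. Qed.

Lemma eE (K : fieldType) i k : (i < 7)%N -> (k < 7)%N -> (e K i)#k = (k == i)%:R.
Proof. by move=> lti ltk; rewrite mxE /= -val_eqE /= !inordK. Qed.

(** Apart from c_00, c_01 and c_11, the product depends on x and y only through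
the 2 x 2 minors w i j; with the bracket in this form, isomorphism conditions
become polynomial identities in the entries. *)
Lemma L_coords (K : fieldType) (C : params K) (x y : 'rV[K]_7) :
  let w i j := x#i * y#j - x#j * y#i in
  L C x y = row7 [:: 0; 0; w 1 0; w 2 0;
    w 3 0 + c12 C * w 1 2;
    w 4 0 + c12 C * w 1 3 + c13 C * w 1 2;
    w 5 0 + c00 C * (x#0 * y#0) + c01 C * (x#0 * y#1) + c11 C * (x#1 * y#1)
      + c14 C * w 1 2 + c13 C * w 1 3 + (c12 C - c23 C) * w 1 4
      + c23 C * w 2 3].
Proof.
move=> w; apply: row7P => k ltk7; rewrite row7E //.
have -> : L C x y = \sum_(0 <= i < 7) \sum_(0 <= j < 7)
    (x#i * y#j) *: basis_mul C i j.
  rewrite /L /= /L_mul big_mkord; apply: eq_bigr => i _.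
  by rewrite big_mkord; apply: eq_bigr => j _; rewrite !inord_val.
rewrite unlock /= /basis_mul /= !mxE -!val_eqE /= !inordK //.
case: k ltk7 => [|[|[|[|[|[|[|//]]]]]]] _ /=; rewrite /w; ring.
Qed.

(** * The parameters are determined by the algebra *)
Lemma params_ext (K : Type) (C C' : params K) :
  c00 C = c00 C' -> c01 C = c01 C' -> c11 C = c11 C' -> c12 C = c12 C' ->
  c13 C = c13 C' -> c14 C = c14 C' -> c23 C = c23 C' -> C = C'.
Proof. by case: C C' => ? ? ? ? ? ? ? [? ? ? ? ? ? ?] /= -> -> -> -> -> -> ->. Qed.

(** Membership of L(C) in the family only provides some parameters with the
same product; this is what transfers their conditions to C. *)
Lemma L_inj (K : fieldType) (C C' : params K) : L C = L C' -> C = C'.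
Proof.
move=> eqL; have eq_entry i j k : (L C (e K i) (e K j))#k = (L C' (e K i) (e K j))#k.
  by rewrite eqL.
apply: params_ext;
  [have := eq_entry 0 0 6 | have := eq_entry 0 1 6 | have := eq_entry 1 1 6
  | have := eq_entry 1 2 4 | have := eq_entry 1 2 5 | have := eq_entry 1 2 6
  | have := eq_entry 2 3 6]; rewrite !L_coords !row7E //= !eE //=;
  by rewrite ?(mulr1n, mulr0n)
    !(mul0r, mulr0, mulr1, subrr, subr0, sub0r, oppr0, addr0, add0r).
Qed.

(** * A family of triangular isomorphisms *)

(** The linear map with e_0 |-> a e_0 and e_1 |-> b e_1 + g e_2, continued by
e_(i+1) = [e_i, e_0], that is, e_i |-> a^(i-1) (b e_i + g e_(i+1))
for i >= 1, where e_7 = 0. *)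
Definition triangular_map {K : fieldType} (a b g : K) (x : 'rV[K]_7) :=
  row7 [:: a * x#0; b * x#1; g * x#1 + a * b * x#2;
    a * g * x#2 + a ^+ 2 * b * x#3; a ^+ 2 * g * x#3 + a ^+ 3 * b * x#4;
    a ^+ 3 * g * x#4 + a ^+ 4 * b * x#5; a ^+ 4 * g * x#5 + a ^+ 5 * b * x#6].

Lemma triangular_map_is_linear (K : fieldType) (a b g : K) :
  linear (triangular_map a b g).
Proof.
move=> t x y; apply: row7P => k ltk7; rewrite row7E // !mxE !inordK //.
by case: k ltk7 => [|[|[|[|[|[|[|//]]]]]]] _ /=; ring.
Qed.

HB.instance Definition _ (K : fieldType) (a b g : K) :=
  GRing.isLinear.Build K 'rV[K]_7 'rV[K]_7 *:%R (triangular_map a b g)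
    (triangular_map_is_linear K a b g).

Lemma triangular_map_bij (K : fieldType) (a b g : K) :
  a != 0 -> b != 0 -> bijective (triangular_map a b g).
Proof.
move=> a0 b0.
pose h (y : 'rV[K]_7) :=
  let x1 := y#1 / b in
  let x2 := (y#2 - g * x1) / (a * b) in
  let x3 := (y#3 - a * g * x2) / (a ^+ 2 * b) in
  let x4 := (y#4 - a ^+ 2 * g * x3) / (a ^+ 3 * b) in
  let x5 := (y#5 - a ^+ 3 * g * x4) / (a ^+ 4 * b) in
  let x6 := (y#6 - a ^+ 4 * g * x5) / (a ^+ 5 * b) in
  row7 [:: y#0 / a; x1; x2; x3; x4; x5; x6].
exists h => x; apply: row7P => k ltk7; rewrite row7E // !row7E //=;
  case: k ltk7 => [|[|[|[|[|[|[|//]]]]]]] _ /=; field; rewrite ?a0 ?b0 //.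
Qed.

(** The target parameters are forced: with E_i the image of e_i, they are read
off from [E_0, E_0], [E_1, E_2] and [E_2, E_3].  In [E_1, E_2] the coefficient of
e_6 is a (b^2 c'_14 + b g c'_13 + g^2 c'_23), to be matched with
c_13 a^4 g + c_14 a^5 b; since b c'_13 = c_13 a^3, only g^2 survives. *)
Lemma isomorphic_triangular (K : fieldType) (c0 c3 c4 d a b g : K) : a != 0 -> b != 0 ->
  isomorphic (L (Params c0 0 0 0 c3 c4 d))
    (L (Params (c0 * a ^+ 3 * b) 0 0 0 (c3 * a ^+ 3 / b)
               (c4 * a ^+ 4 / b - d * g ^+ 2 * a ^+ 2 / b ^+ 3)
               (d * a ^+ 2 / b))).
Proof.
move=> a0 b0; exists (triangular_map a b g); first exact: triangular_map_bij.
move=> x y; apply: row7P => k ltk7; rewrite /= !L_coords /triangular_map !row7E //=.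
by case: k ltk7 => [|[|[|[|[|[|[|//]]]]]]] _ /=; field; rewrite ?a0 ?b0 //.
Qed.

(** * What an isomorphism preserves *)
Definition in_filtration {K : fieldType} (k : nat) (x : 'rV[K]_7) :=
  forall i, (i < k)%N -> x#i = 0.

(** From index 2 on, the only product e_k y with a component on e_(k+1) is the
one with y = e_0; all the others land on larger indices. *)
Lemma filtration_step (K : fieldType) (C : params K) k (x y : 'rV[K]_7) :
  (2 <= k < 6)%N -> in_filtration k x ->
  in_filtration k.+1 (L C x y) /\ (L C x y)#k.+1 = x#k * y#0.
Proof.
move=> /andP[le2k ltk6] Fx; have ltk7 : (k < 7)%N by apply: ltnW.
rewrite L_coords; split=> [i ltik|]; rewrite row7E ?(leq_trans ltik) //.
  case: k le2k ltk6 ltk7 Fx ltik => [|[|[|[|[|[|//]]]]]] // _ _ _ Fx;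
  by case: i => [|[|[|[|[|[|[|//]]]]]]] //= _; rewrite !Fx //; ring.
case: k le2k ltk6 ltk7 Fx => [|[|[|[|[|[|//]]]]]] // _ _ _ Fx /=;
  rewrite (Fx 0) //; first ring.
- by rewrite (Fx 1) // (Fx 2) //; ring.
- by rewrite (Fx 1) // (Fx 2) // (Fx 3) //; ring.
by rewrite (Fx 1) // (Fx 2) // (Fx 3) // (Fx 4) //; ring.
Qed.

(** Here a is the e_0 component of the image of e_0, and b the e_1 component of
the image of e_1.  The filtration is used only for the images of e_2, ..., e_6,
so that nothing about f(e_1) has to be known beforehand. *)
Lemma isomorphic_coefs (K : fieldType) (C C' : params K) :
  c12 C = 0 -> c01 C' = 0 -> c11 C' = 0 -> c12 C' = 0 ->
  isomorphic (L C) (L C') ->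
  exists a b : K, [/\ a != 0, b != 0, c23 C' * b = c23 C * a ^+ 2,
    c13 C' * b = c13 C * a ^+ 3 & c00 C' = c00 C * a ^+ 3 * b].
Proof.
move=> z12 z01' z11' z12' [f bij_f mulf].
pose E i := f (e K i).
have fL i j : (i < 7)%N -> (j < 7)%N ->
    L C' (E i) (E j) = f (basis_mul C i j).
  by move=> lti ltj; rewrite -L_basis // mulf.
have EL i : (1 <= i < 6)%N -> E i.+1 = L C' (E i) (E 0).
  case/andP=> lt0i lti6; rewrite fL ?(leqW lti6) //.
  by case: i lt0i lti6 => [|[|[|[|[|[|]]]]]].
pose a := (E 0)#0; pose d := (E 2)#2.
have F2 : in_filtration 2 (E 2).
  by move=> i; rewrite EL // L_coords; case: i => [|[|//]] _; rewrite row7E.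
have [F3 E3] : in_filtration 3 (E 3) /\ (E 3)#3 = d * a.
  by rewrite (EL 2) //; apply: filtration_step.
have [F4 E4] : in_filtration 4 (E 4) /\ (E 4)#4 = d * a ^+ 2.
  by rewrite (EL 3) // exprSr mulrA -E3; apply: filtration_step.
have [F5 E5] : in_filtration 5 (E 5) /\ (E 5)#5 = d * a ^+ 3.
  by rewrite (EL 4) // exprSr mulrA -E4; apply: filtration_step.
have [F6 E6] : in_filtration 6 (E 6) /\ (E 6)#6 = d * a ^+ 4.
  by rewrite (EL 5) // exprSr mulrA -E5; apply: filtration_step.
(* d a^4 is the only entry of f(e_6) that could be nonzero. *)
have da_neq0 : d * a ^+ 4 != 0.
  apply/eqP=> da0; have /eqP := oner_neq0 K; apply.
  have -> : 1 = (e K 6)#6 by rewrite eE.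
  suff -> : e K 6 = 0 by rewrite mxE.
  apply: (bij_inj bij_f); rewrite linear0; apply: row7P => k.
  rewrite ltnS leq_eqVlt mxE => /predU1P[-> | /F6 //].
  by rewrite -da0 -E6.
have [d0 a0] : d != 0 /\ a != 0.
  by move: da_neq0; rewrite mulf_eq0 negb_or expf_eq0 /= => /andP[].
have E12 : L C' (E 1) (E 2) = c13 C *: E 5 + c14 C *: E 6.
  by rewrite fL //= z12 scale0r add0r linearD !linearZ.
(* [e_1, e_2] has no e_3 component and neither does its image, but the e_0
   component of f(e_1) would contribute - d times itself there. *)
have b0 : (E 1)#0 = 0.
  have := congr1 (fun x : 'rV[K]_7 => x#3) E12.
  rewrite L_coords row7E //= !mxE (F5 3) // (F6 3) // (F2 0) // -/d => eq3.
  apply: (mulIf d0); apply: oppr_inj.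
  by move: eq3; rewrite !(mulr0, mul0r, addr0, add0r, sub0r, oppr0).
have dE : d = a * (E 1)#1.
  by rewrite /d EL // L_coords row7E //= b0 -/a; ring.
set b := (E 1)#1 in dE.
have b_neq0 : b != 0 by move: d0; rewrite dE mulf_eq0 negb_or => /andP[].
exists a, b; split=> //.
- have := congr1 (fun x : 'rV[K]_7 => x#6) (fL 2 3 isT isT).
  rewrite /= linearZ /= L_coords row7E //= mxE -/(E 6) E6 E3
    (F2 0) // (F2 1) // (F3 0) // (F3 1) // (F3 2) // -/d dE.
  move=> eq6; apply: (mulIf (mulf_neq0 b_neq0 (expf_neq0 3 a0))).
  by transitivity (c23 C * (a * b * a ^+ 4)); [rewrite -eq6; ring | ring].
- have := congr1 (fun x : 'rV[K]_7 => x#5) E12.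
  rewrite L_coords row7E //= !mxE E5 F6 // z12' b0 (F2 0) // (F2 1) // -/d -/b dE => eq5.
  apply: (mulIf (mulf_neq0 a0 b_neq0)).
  by transitivity (c13 C * (a * b * a ^+ 3) + c14 C * 0); [rewrite -eq5; ring | ring].
have := congr1 (fun x : 'rV[K]_7 => x#6) (fL 0 0 isT isT).
rewrite /= linearZ /= L_coords row7E //= mxE -/(E 6) E6 z01' z11' -/a dE.
move=> eq6; apply: (mulIf (mulf_neq0 a0 a0)).
by transitivity (c00 C * (a * b * a ^+ 4)); [rewrite -eq6; ring | ring].
Qed.

(** * Classification *)
Lemma U75_coefs (K : fieldType) (C : params K) : U75 (L C) ->
  [/\ c23 C != 0, [/\ c11 C = 0, c01 C = 0 & c12 C = 0] & c13 C != 0].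
Proof. by case=> C0 C0P /L_inj <-. Qed.

Definition orbit_invariant {K : fieldType} (C : params K) :=
  c23 C ^+ 6 * c00 C / c13 C ^+ 5.

Lemma sqr_surj (K : closedFieldType) (z : K) : exists g : K, g ^+ 2 = z.
Proof.
have [g g2] := solve_monicpoly (fun i => if i is 0%N then z else 0) (ltn0Sn 1).
by exists g; rewrite g2 !big_ord_recl big_ord0 /= mulr1 mul0r !addr0.
Qed.

Lemma isomorphic_iff_invariant (K : closedFieldType) (C C' : params K) :
  U75 (L C) -> U75 (L C') ->
  isomorphic (L C) (L C') <-> orbit_invariant C' = orbit_invariant C.
Proof.
move=> /U75_coefs[d0 [z11 z01 z12] n0] /U75_coefs[d0' [z11' z01' z12'] n0'].
split=> [/(isomorphic_coefs _ _ _ z12 z01' z11' z12')[a [b [a0 b0 Ed En E0]]]|inv].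
  rewrite /orbit_invariant E0.
  have -> : c23 C = c23 C' * b / a ^+ 2 by rewrite Ed; field.
  have -> : c13 C = c13 C' * b / a ^+ 3 by rewrite En; field.
  by field; rewrite ?a0 ?b0 ?n0'.
(* a and b solve the equations of isomorphic_coefs for c_13 and c_23; the one
   for c_00 is then the equality of invariants, and g corrects c_14. *)
pose a := c23 C * c13 C' / (c23 C' * c13 C).
pose b := c23 C * a ^+ 2 / c23 C'.
have a0 : a != 0 by rewrite !mulf_neq0 ?invr_eq0 ?mulf_neq0.
have b0 : b != 0 by rewrite mulf_neq0 ?invr_eq0 // mulf_neq0 // expf_neq0.
have [g g2] := sqr_surj _
  ((c14 C * a ^+ 4 / b - c14 C') * b ^+ 3 / (c23 C * a ^+ 2)).
have := isomorphic_triangular K (c00 C) (c13 C) (c14 C) (c23 C) a b g a0 b0.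
have -> : Params (c00 C) 0 0 0 (c13 C) (c14 C) (c23 C) = C
  by apply: params_ext; rewrite /= ?z01 ?z11 ?z12.
suff -> : C' = Params (c00 C * a ^+ 3 * b) 0 0 0 (c13 C * a ^+ 3 / b)
    (c14 C * a ^+ 4 / b - c23 C * g ^+ 2 * a ^+ 2 / b ^+ 3)
    (c23 C * a ^+ 2 / b) by [].
apply: params_ext => //=.
- have -> : c00 C' = orbit_invariant C' * c13 C' ^+ 5 / c23 C' ^+ 6.
    by rewrite /orbit_invariant; field; rewrite d0' n0'.
  by rewrite inv /orbit_invariant /b /a; field; rewrite ?d0 ?n0 ?d0' ?n0'.
- by rewrite /b /a; field; rewrite ?d0 ?n0 ?d0' ?n0'.
- by rewrite g2; field; rewrite ?a0 ?b0 ?d0.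
by rewrite /b; field; rewrite ?a0 ?d0 ?d0'.
Qed.

Lemma U75_normal_form (K : fieldType) (l : K) : U75 (L (Params l 0 0 0 1 0 1)).
Proof. by exists (Params l 0 0 0 1 0 1) => //; split; rewrite ?oner_neq0. Qed.

Lemma orbit_invariant_normal_form (K : fieldType) (l : K) :
  orbit_invariant (Params l 0 0 0 1 0 1) = l.
Proof. by rewrite /orbit_invariant /= !expr1n mul1r divr1. Qed.

Theorem proposition2p5 (R : realType) :
  [/\ forall C C' : params R[i], U75 (L C) -> U75 (L C') ->
        (isomorphic (L C) (L C') <->
         c23 C' ^+ 6 * c00 C' / c13 C' ^+ 5 = c23 C ^+ 6 * c00 C / c13 C ^+ 5),
      forall lambda : R[i], exists C : params R[i],
        U75 (L C) /\ c23 C ^+ 6 * c00 C / c13 C ^+ 5 = lambda,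
      forall lambda : R[i], U75 (L (Params lambda 0 0 0 1 0 1))
    & forall A : {bilinear 'rV[R[i]]_7 -> 'rV[R[i]]_7 -> 'rV[R[i]]_7},
        U75 A ->
        exists lambda : R[i], isomorphic A (L (Params lambda 0 0 0 1 0 1))].
Proof.
split=> [C C' UC UC' | l | l | _ [C UC <-]].
- exact: (isomorphic_iff_invariant R[i] C C' UC UC').
- exists (Params l 0 0 0 1 0 1); split; first exact: U75_normal_form.
  exact: orbit_invariant_normal_form.
- exact: U75_normal_form.
exists (orbit_invariant C).
apply/(isomorphic_iff_invariant R[i] C _ _ (U75_normal_form _ _)); first by exists C.
exact: orbit_invariant_normal_form.
Qed.
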